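(* Let $\mathcal{H}=\oplus_{i\in\mathbb{Z}}\mathcal{H}_i$ be a graded $\mathbb{C}[\partial]$-module and let $\{\varrho_k:\mathcal{H}^{\otimes k}\to\mathcal{H}[[\lambda_1,\ldots,\lambda_{k-1}]]\}_{k\ge 1}$ be a collection of degree $-1$ conformal sesquilinear maps. Then the pair $(\mathcal{H},\{\varrho_k\}_{k\ge 1})$ is a $Leib_\infty[1]$-conformal algebra if and only if the element $\varrho=\sum_{k\ge 1}\varrho_k\in C^{-1}_{cs}(\mathcal{H})$ is a Maurer-Cartan element of the graded Lie algebra $(C^\bullet_{cs}(\mathcal{H}),[\![\cdot,\cdot]\!])$, i.e. $[\![\varrho,\varrho]\!]=0$.
   Context: Tensor products are over $\mathbb{C}$. For a graded $\mathbb{C}[\partial]$-module $\mathcal{H}=\oplus_i\mathcal{H}_i$, the space $\mathcal{H}[[\lambda_1,\ldots,\lambda_{k-1}]]$ is graded by $\oplus_i\mathcal{H}_i[[\lambda_1,\ldots,\lambda_{k-1}]]$, with $\partial$ acting coefficientwise; multilinear operations are extended coefficientwise to formal power series arguments. Conformal sesquilinear map: a $\mathbb{C}$-linear map $\varphi:\mathcal{H}^{\otimes k}\to\mathcal{H}[[\lambda_1,\ldots,\lambda_{k-1}]]$, written $\varphi_{\lambda_1,\ldots,\lambda_{k-1}}(h_1,\ldots,h_k)$, such that $\varphi_{\lambda_1,\ldots,\lambda_{k-1}}(h_1,\ldots,\partial h_i,\ldots,h_k)=-\lambda_i\,\varphi_{\lambda_1,\ldots,\lambda_{k-1}}(h_1,\ldots,h_k)$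 for $1\le i\le k-1$, and $\varphi_{\lambda_1,\ldots,\lambda_{k-1}}(h_1,\ldots,h_{k-1},\partial h_k)=(\partial+\lambda_1+\cdots+\lambda_{k-1})\varphi_{\lambda_1,\ldots,\lambda_{k-1}}(h_1,\ldots,h_k)$. For $k=1$ this means $\mathbb{C}[\partial]$-linear. $\mathrm{Sh}(i-1,l-1)$ is the set of $(i-1,l-1)$-shuffles, i.e. permutations $\sigma$ of $\{1,\ldots,i+l-2\}$ with $\sigma(1)<\cdots<\sigma(i-1)$ and $\sigma(i)<\cdots<\sigma(i+l-2)$; $\varepsilon(\sigma)$ is the Koszul sign of $\sigma$ acting on the homogeneous elements involved. For conformal sesquilinear $\varphi_k$ (with $k$ inputs), $\psi_l$ (with $l$ inputs), $\psi_l$ of degree $m$, and $p=k+l-1$, define $$(\varphi_k\diamond\psi_l)_{\lambda_1,\ldots,\lambda_{p-1}}(h_1,\ldots,h_p)=\sum_{i=1}^k\sum_{\sigma\in\mathrm{Sh}(i-1,l-1)}\varepsilon(\sigma)(-1)^{m(|h_{\sigma(1)}|+\cdots+|h_{\sigma(i-1)}|)}$$ $$(\varphi_k)_{\lambda_{\sigma(1)},\ldots,\lambda_{\sigma(i-1)},\,\lambda_{\sigma(i)}+\cdots+\lambda_{\sigma(i+l-2)}+\lambda_{i+l-1},\,\lambda_{i+l},\ldots,\lambda_{p-1}}\big(h_{\sigma(1)},\ldots,h_{\sigma(i-1)},(\psi_l)_{\lambda_{\sigma(i)},\ldots,\lambda_{\sigma(i+l-2)}}(h_{\sigma(i)},\ldots,h_{\sigma(i+l-2)},h_{i+l-1}),h_{i+l},\ldots,h_p\big),$$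 where, when $i=k$, the subscript list of $\varphi_k$ consists only of $\lambda_{\sigma(1)},\ldots,\lambda_{\sigma(k-1)}$. $C^n_{cs}(\mathcal{H})$ is the space of formal sums $\sum_{k\ge1}\varphi_k$ with $\varphi_k:\mathcal{H}^{\otimes k}\to\mathcal{H}[[\lambda_1,\ldots,\lambda_{k-1}]]$ conformal sesquilinear of degree $n$. The graded space $C^\bullet_{cs}(\mathcal{H})=\oplus_{n\in\mathbb{Z}}C^n_{cs}(\mathcal{H})$ is a graded Lie algebra with bracket, for $\varphi=\sum_k\varphi_k\in C^n_{cs}(\mathcal{H})$ and $\psi=\sum_l\psi_l\in C^m_{cs}(\mathcal{H})$, $$[\![\varphi,\psi]\!]=\sum_{p\ge1}\sum_{k+l=p+1}\big(\varphi_k\diamond\psi_l-(-1)^{mn}\psi_l\diamond\varphi_k\big).$$ A $Leib_\infty[1]$-conformal algebra is a pair $(\mathcal{H},\{\varrho_k\}_{k\ge1})$ of a graded $\mathbb{C}[\partial]$-module and conformal sesquilinear maps $\varrho_k:\mathcal{H}^{\otimes k}\to\mathcal{H}[[\lambda_1,\ldots,\lambda_{k-1}]]$ of degree $-1$ such that for all $n\ge1$ and homogeneous $h_1,\ldots,h_n\in\mathcal{H}$, $$\sum_{k+l=n+1}\sum_{i=1}^k\sum_{\sigma\in\mathrm{Sh}(i-1,l-1)}\varepsilon(\sigma)(-1)^{|h_{\sigma(1)}|+\cdots+|h_{\sigma(i-1)}|}(\varrho_k)_{\lambda_{\sigma(1)},\ldots,\lambda_{\sigma(i-1)},\lambda_{\sigma(i)}+\cdots+\lambda_{\sigma(i+l-2)}+\lambda_{i+l-1},\lambda_{i+l},\ldots,\lambda_{n-1}}\big(h_{\sigma(1)},\ldots,h_{\sigma(i-1)},(\varrho_l)_{\lambda_{\sigma(i)},\ldots,\lambda_{\sigma(i+l-2)}}(h_{\sigma(i)},\ldots,h_{\sigma(i+l-2)},h_{i+l-1}),h_{i+l},\ldots,h_n\big)=0,$$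 with the same subscript convention when $i=k$. *)

(* Defs.v *)
From HB Require Import structures.
From mathcomp Require Import all_boot all_order all_algebra.
From mathcomp Require Import fingroup perm.
From mathcomp Require Import finmap mpoly complex.
From mathcomp Require Import boolp reals.

Set Implicit Arguments.
Unset Strict Implicit.
Unset Printing Implicit Defensive.

Import Order.TTheory GRing.Theory Num.Theory.

Local Open Scope ring_scope.

(* A C[partial]-module is a C-vector space with an endomorphism [gm_partial];  *)
(* [gm_homog d x] means that x lies in the component H_d, and [gm_decomp] says *)
(* that H is the internal direct sum of the H_d.  The zero vector belongs to   *)
(* every H_d, so formulas involving |x| take the degree as a separate datum.   *)
Record gradedModule (C : fieldType) := GradedModule {
  gm_sort :> lmodType C;
  gm_partial : {linear gm_sort -> gm_sort};
  gm_homog : int -> gm_sort -> Prop;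
  gm_homog0 : forall d, gm_homog d 0;
  gm_homogP : forall d (a : C) (x y : gm_sort),
    gm_homog d x -> gm_homog d y -> gm_homog d (a *: x + y);
  gm_partial_homog : forall d (x : gm_sort),
    gm_homog d x -> gm_homog d (gm_partial x);
  gm_decomp : forall x : gm_sort,
    exists! f : {fsfun int -> gm_sort with 0},
      (forall d, gm_homog d (f d)) /\ x = \sum_(d <- finsupp f) f d
}.

Definition hcomp (C : fieldType) (H : gradedModule C) (x : H) :
  {fsfun int -> H with 0} := sval (cid (gm_decomp x)).

(* H[[l_0, ..., l_(n-1)]]: a series is its family of coefficients, indexed by  *)
(* exponents.                                                                  *)
Definition pseries (C : fieldType) (H : gradedModule C) (n : nat) : Type :=
  'X_{1..n} -> H.

Definition ps_mul (C : fieldType) (H : gradedModule C) (n : nat)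
    (P : {mpoly C[n]}) (f : pseries H n) : pseries H n :=
  fun g => \sum_(b : 'X_{1..n < (mdeg g).+1} | (b <= g)%MM)
    P@_(g - b) *: f b.

(* f(L_0, ..., L_(n-1)).  Bounding the exponents by mdeg g is legitimate       *)
(* because all the L_j used below are homogeneous linear forms, so that        *)
(* prod_j L_j ^ a_j is homogeneous of degree mdeg a.                           *)
Definition ps_subst (C : fieldType) (H : gradedModule C) (n N : nat)
    (L : 'I_n -> {mpoly C[N]}) (f : pseries H n) : pseries H N :=
  fun g => \sum_(a : 'X_{1..n < (mdeg g).+1})
    (\prod_(j < n) L j ^+ (a : 'X_{1..n}) j)@_g *: f a.

(* Maps with k.+1 inputs and values in H[[l_0, ..., l_(k-1)]]; linear maps on  *)
(* the tensor power are represented as multilinear maps (see [multilinear]).   *)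
Definition multimap (C : fieldType) (H : gradedModule C) (k : nat) : Type :=
  {ffun 'I_k.+1 -> H} -> pseries H k.

Definition upd (T : Type) (k : nat) (h : {ffun 'I_k -> T}) (i : 'I_k) (x : T) :
  {ffun 'I_k -> T} := [ffun j => if j == i then x else h j].

Definition multilinear (C : fieldType) (H : gradedModule C) (k : nat)
    (phi : multimap H k) : Prop :=
  forall (h : {ffun 'I_k.+1 -> H}) (i : 'I_k.+1) (a : C) (x y : H) g,
    phi (upd h i (a *: x + y)) g = a *: phi (upd h i x) g + phi (upd h i y) g.

Definition conformal_sesquilinear (C : fieldType) (H : gradedModule C)
    (k : nat) (phi : multimap H k) : Prop :=
  [/\ multilinear phi,
      (forall (h : {ffun 'I_k.+1 -> H}) (i : 'I_k) g,
         let i' := widen_ord (leqnSn k) i in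
         phi (upd h i' (gm_partial H (h i'))) g = ps_mul (- 'X_i) (phi h) g)
    & (forall (h : {ffun 'I_k.+1 -> H}) g,
         phi (upd h ord_max (gm_partial H (h ord_max))) g
         = gm_partial H (phi h g) + ps_mul (\sum_(i < k) 'X_i) (phi h) g)].

Definition has_degree (C : fieldType) (H : gradedModule C) (k : nat) (n : int)
    (phi : multimap H k) : Prop :=
  forall (d : {ffun 'I_k.+1 -> int}) (h : {ffun 'I_k.+1 -> H}),
    (forall j, gm_homog (d j) (h j)) ->
    forall g, gm_homog (n + \sum_j d j) (phi h g).

(* Formal sums: component k is the map with k.+1 inputs.                       *)
Definition cochain (C : fieldType) (H : gradedModule C) : Type :=
  forall k : nat, multimap H k.

Definition cochain0 (C : fieldType) (H : gradedModule C) : cochain H :=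
  fun _ _ _ => 0.

Arguments cochain0 {C} H _ _ _.

Record Ccs (C : fieldType) (H : gradedModule C) (n : int) := CcsElement {
  ccs_val :> forall k : nat, multimap H k;
  ccs_sesquilinear : forall k, conformal_sesquilinear (@ccs_val k);
  ccs_degree : forall k, has_degree n (@ccs_val k)
}.

Arguments ccs_val {C H n} _ _ _ _.

(* With 0-based indices, a permutation of {0, ..., i + l - 1} is a             *)
(* (i, l)-shuffle when it is increasing on the first i and on the last l       *)
(* positions.                                                                  *)
Definition is_shuffle (i l : nat) (s : 'S_(i + l)) : bool :=
  [forall a : 'I_i, forall b : 'I_i,
     (a < b)%N ==> (s (lshift l a) < s (lshift l b))%N] &&
  [forall a : 'I_l, forall b : 'I_l,
     (a < b)%N ==> (s (rshift i a) < s (rshift i b))%N].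

(* The action of s on natural numbers, and the variable l_j of                 *)
(* {mpoly C[N]} for a natural number j; the default values are never reached   *)
(* in the formulas below when N = k + l.  In the same way, h (inord j) below   *)
(* always has j <= N.                                                          *)
Definition perm_nat (n : nat) (s : 'S_n) (j : nat) : nat :=
  oapp (fun a : 'I_n => s a : nat) j (insub j).

Definition lam (C : fieldType) (N : nat) (j : nat) : {mpoly C[N]} :=
  oapp (fun a : 'I_N => 'X_a) 0 (insub j).

Definition koszul (C : fieldType) (N n : nat) (s : 'S_n)
    (d : {ffun 'I_N.+1 -> int}) : C :=
  \prod_(a < n) \prod_(b < n | (a < b)%N && (s b < s a)%N)
    (-1) ^ (d (inord (s a)) * d (inord (s b))).

(* The composite of phi (k.+1 inputs) with psi (l.+1 inputs) plugged in slot i *)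
(* after the shuffle s, as a series in l_0, ..., l_(N-1), for N = k + l:       *)
(* psi yields a series, whose coefficients are fed to phi one by one.          *)
(* For i = k no index a : 'I_k satisfies a >= i, so that only the variables    *)
(* l_(s a), a < k, are substituted in phi.                                     *)
Section Insertion.
Context (C : fieldType) (H : gradedModule C) (k l N i : nat) (s : 'S_(i + l)).

Definition inner_args (h : {ffun 'I_N.+1 -> H}) : {ffun 'I_l.+1 -> H} :=
  [ffun b : 'I_l.+1 =>
     h (inord (if (b < l)%N then perm_nat s (i + b) else (i + l)%N))].

Definition inner_vars (b : 'I_l) : {mpoly C[N]} :=
  lam C N (perm_nat s (i + b)).

Definition outer_args (h : {ffun 'I_N.+1 -> H}) (x : H) :
    {ffun 'I_k.+1 -> H} :=
  [ffun a : 'I_k.+1 =>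
     if (a < i)%N then h (inord (perm_nat s a))
     else if a == i :> nat then x
     else h (inord (a + l))].

Definition outer_vars (a : 'I_k) : {mpoly C[N]} :=
  if (a < i)%N then lam C N (perm_nat s a)
  else if a == i :> nat then
    \sum_(b < l) lam C N (perm_nat s (i + b)) + lam C N (i + l)
  else lam C N (a + l).

Definition insertion (phi : multimap H k) (psi : multimap H l)
    (h : {ffun 'I_N.+1 -> H}) : pseries H N :=
  fun g => \sum_(b : 'X_{1..N < (mdeg g).+1} | (b <= g)%MM)
    ps_subst outer_vars
      (phi (outer_args h (ps_subst inner_vars (psi (inner_args h)) b)))
      (g - b)%MM.

End Insertion.

(* The diamond product on homogeneous inputs h_j of degrees d_j, psi being of  *)
(* degree m; it is meaningful for N = k + l.                                   *)
Definition diamond_homog (C : fieldType) (H : gradedModule C) (k l N : nat)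
    (m : int) (phi : multimap H k) (psi : multimap H l)
    (d : {ffun 'I_N.+1 -> int}) (h : {ffun 'I_N.+1 -> H}) : pseries H N :=
  fun g => \sum_(i < k.+1) \sum_(s : 'S_(i + l) | is_shuffle s)
    (koszul C s d * (-1) ^ (m * \sum_(j < i) d (inord (perm_nat s j))))
      *: insertion s phi psi h g.

(* Its linear extension to arbitrary inputs: each input is split into its      *)
(* homogeneous components.  [hsupp h] contains all the degrees that occur;     *)
(* the remaining ones contribute 0 by multilinearity.                          *)
Definition hsupp (C : fieldType) (H : gradedModule C) (n : nat)
    (h : {ffun 'I_n -> H}) : {fset int} :=
  \big[fsetU/fset0]_(j < n) finsupp (hcomp (h j)).

Definition diamond (C : fieldType) (H : gradedModule C) (k l N : nat)
    (m : int) (phi : multimap H k) (psi : multimap H l) : multimap H N :=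
  fun h g => \sum_(d : {ffun 'I_N.+1 -> hsupp h})
    diamond_homog m phi psi [ffun j => val (d j)]
      [ffun j => hcomp (h j) (val (d j))] g.

(* Component N has N.+1 inputs, hence the condition k + l = N on the shifted   *)
(* arities.                                                                    *)
Definition bracket (C : fieldType) (H : gradedModule C) (n m : int)
    (phi : Ccs H n) (psi : Ccs H m) : cochain H :=
  fun N h g => \sum_(k < N.+1) \sum_(l < N.+1 | (k + l == N)%N)
    (diamond m (phi k) (psi l) h g
     - (-1) ^ (m * n) *: diamond n (psi l) (phi k) h g).

Definition maurer_cartan (C : fieldType) (H : gradedModule C)
    (x : Ccs H (-1)) : Prop := bracket x x = cochain0 H.

Definition leib_infty1_identity (C : fieldType) (H : gradedModule C)
    (rho : forall k, multimap H k) : Prop :=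
  forall (N : nat) (d : {ffun 'I_N.+1 -> int}) (h : {ffun 'I_N.+1 -> H}),
    (forall j, gm_homog (d j) (h j)) ->
    forall g : 'X_{1..N},
      \sum_(k < N.+1) \sum_(l < N.+1 | (k + l == N)%N)
        \sum_(i < k.+1) \sum_(s : 'S_(i + l) | is_shuffle s)
          (koszul C s d * (-1) ^ (\sum_(j < i) d (inord (perm_nat s j))))
            *: insertion s (rho k) (rho l) h g = 0.

Definition leib_infty1_conformal (C : fieldType) (H : gradedModule C)
    (rho : forall k, multimap H k) : Prop :=
  [/\ forall k, conformal_sesquilinear (rho k),
      forall k, has_degree (-1) (rho k)
    & leib_infty1_identity rho].

(* Main.v *)
(** The sign of the second term of the bracket of [rho] with itself is
    [(-1) ^ ((-1) * (-1)) = -1], so that exchanging [k] and [l] gives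
    [[rho, rho]] = 2 (rho <> rho).  On homogeneous inputs the only family of
    homogeneous components that contributes to rho <> rho is the input itself,
    and there rho <> rho is the left-hand side of the Leib_infty[1] identity. *)
Require Import Defs.
From mathcomp Require Import all_boot all_order all_algebra.
From mathcomp Require Import complex.
From mathcomp Require Import reals.
From mathcomp Require Import fingroup perm finmap mpoly boolp zify.

Set Implicit Arguments.
Unset Strict Implicit.
Unset Printing Implicit Defensive.

Import GRing.Theory Num.Theory.

Local Open Scope ring_scope.

Section LeibMaurerCartan.
Variables (C : fieldType) (H : gradedModule C).

Lemma multilinear_arg0 (k : nat) (phi : multimap H k) (h : {ffun 'I_k.+1 -> H})
    (i : 'I_k.+1) g :
  multilinear phi -> h i = 0 -> phi h g = 0.
Proof.
(* With coefficient -1 and zero vectors the right-hand side has the form [- v + v], so it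
   cancels. *)
move=> phi_lin hi0; have /= := phi_lin h i (-1) 0 0 g.
rewrite scaler0 addr0 scaleN1r addNr.
suff -> : upd h i 0 = h by [].
by apply/ffunP=> j; rewrite ffunE; case: eqP => // ->.
Qed.

Lemma ps_subst_eq0 (n N : nat) (L : 'I_n -> {mpoly C[N]}) (f : pseries H n) g :
  (forall a, f a = 0) -> ps_subst L f g = 0.
Proof. by move=> f0; rewrite /ps_subst big1 // => a _; rewrite f0 scaler0. Qed.

Lemma perm_nat_ord (n : nat) (s : 'S_n) (a : 'I_n) : perm_nat s a = s a.
Proof. by rewrite /perm_nat valK. Qed.

(** Each of the [k + l + 1] inputs lands in some slot of [phi] or of [psi], so a zero input meets
    multilinearity there. *)
Lemma insertion_arg0 (k l N i : nat) (s : 'S_(i + l)) (phi : multimap H k)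
    (psi : multimap H l) (h : {ffun 'I_N.+1 -> H}) (j : 'I_N.+1) g :
  multilinear phi -> multilinear psi -> (k + l)%N = N -> (i <= k)%N ->
  h j = 0 -> insertion s phi psi h g = 0.
Proof.
move=> phi_lin psi_lin Nkl le_ik hj0; rewrite /insertion big1 // => b _.
apply: ps_subst_eq0 => a.
(* A zero input of [psi] kills its whole series, hence every coefficient fed to slot [i] of
   [phi]. *)
have inner0 (c : 'I_l.+1) : inner_args s h c = 0 ->
    phi (outer_args k s h
      (ps_subst (inner_vars C N s) (psi (inner_args s h)) b)) a = 0.
  move=> c0; apply: (@multilinear_arg0 _ _ _ (Ordinal (le_ik : i < k.+1)%N)) => //.
  rewrite ffunE /= ltnn eqxx ps_subst_eq0 // => a'.
  exact: (multilinear_arg0 (i := c)).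
(* Inputs before [i + l] are shuffled: the preimage [c] of [j] is slot [c] of [phi] or slot [c - i]
   of [psi]. Input [i + l] is the last one of [psi], and a later [j] sits in slot [j - l] of
   [phi]. *)
have [lt_j | lt_j | eq_j] := ltngtP j (i + l)%N.
- pose c := (s^-1)%g (Ordinal lt_j).
  have sc : perm_nat s c = j by rewrite perm_nat_ord permKV.
  have [lt_ci | le_ic] := ltnP c i.
    have lt_ck : (c < k.+1)%N by lia.
    apply: (multilinear_arg0 (i := Ordinal lt_ck)) => //.
    by rewrite ffunE /= lt_ci sc inord_val.
  have lt_cl : (c - i < l)%N by have := ltn_ord c; lia.
  apply: (inner0 (widen_ord (leqnSn l) (Ordinal lt_cl))).
  by rewrite ffunE /= lt_cl subnKC // sc inord_val.
- have lt_jk : (j - l < k.+1)%N by have := ltn_ord j; lia.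
  apply: (multilinear_arg0 (i := Ordinal lt_jk)) => //.
  rewrite ffunE /= ifF; last by apply/negbTE; lia.
  rewrite ifF; last by apply/negbTE/eqP; lia.
  by rewrite subnK ?inord_val //; lia.
- apply: (inner0 ord_max).
  by rewrite ffunE /= ltnn -eq_j inord_val.
Qed.

Lemma diamond_homog_arg0 (k l N : nat) (m : int) (phi : multimap H k)
    (psi : multimap H l) d (h : {ffun 'I_N.+1 -> H}) (j : 'I_N.+1) g :
  multilinear phi -> multilinear psi -> (k + l)%N = N -> h j = 0 ->
  diamond_homog m phi psi d h g = 0.
Proof.
move=> phi_lin psi_lin Nkl hj0; rewrite /diamond_homog big1 // => i _.
rewrite big1 // => s _; rewrite (insertion_arg0 _ _ phi_lin psi_lin Nkl _ hj0) ?scaler0 //.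
by have := ltn_ord i; lia.
Qed.

Lemma hcomp_homog (x : H) d : gm_homog d (hcomp x d).
Proof. by rewrite /hcomp; case: cid => f /= [[]]. Qed.

(** Uniqueness of the decomposition identifies [hcomp x] with the family concentrated in degree
    [d]. *)
Lemma hcomp_of_homog (x : H) (d e : int) :
  gm_homog d x -> hcomp x e = if e == d then x else 0.
Proof.
move=> x_d; rewrite /hcomp; case: cid => f /= [_ f_uniq].
pose x_at_d : {fsfun int -> H with 0} := [fsfun [fsfun] with d |-> x].
have x_at_dE c : x_at_d c = if c == d then x else 0.
  by rewrite fsfun_withE fsfun0E.
rewrite -x_at_dE -(f_uniq x_at_d) //; split=> [c|].
  by rewrite x_at_dE; case: eqP => [-> //|_]; apply: gm_homog0.
(* For [x = 0] the support of [x_at_d] is empty rather than the singleton of [d]. *)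
have [x0|x_n0] := eqVneq x 0.
  by rewrite big1 // => c _; rewrite x_at_dE x0 if_same.
have -> : finsupp x_at_d = [fset d]%fset.
  by apply/fsetP=> c; rewrite mem_finsupp x_at_dE inE; case: (c == d); rewrite ?eqxx.
by rewrite big_seq_fset1 x_at_dE eqxx.
Qed.

Lemma mem_hsupp (n : nat) (h : {ffun 'I_n -> H}) (j : 'I_n) (d : int) :
  gm_homog d (h j) -> h j != 0 -> d \in hsupp h.
Proof.
move=> hj_d hj_n0; apply/bigfcupP; exists j; first by rewrite mem_index_enum.
by rewrite mem_finsupp (hcomp_of_homog _ hj_d) eqxx.
Qed.

Lemma diamond_of_homog (k l N : nat) (m : int) (phi : multimap H k)
    (psi : multimap H l) (d : {ffun 'I_N.+1 -> int})
    (h : {ffun 'I_N.+1 -> H}) g :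
  multilinear phi -> multilinear psi -> (k + l)%N = N ->
  (forall j, gm_homog (d j) (h j)) ->
  diamond m phi psi h g = diamond_homog m phi psi d h g.
Proof.
move=> phi_lin psi_lin Nkl h_d; rewrite /diamond.
(* A zero [h j] has no components, so [d j] may be missing from [hsupp h]; both sides vanish in that
   case. *)
have [/existsP[j /eqP hj0] | /existsPn h_n0] := boolP [exists j, h j == 0].
  rewrite (diamond_homog_arg0 _ _ _ phi_lin psi_lin Nkl hj0) // big1 // => d' _.
  apply: (@diamond_homog_arg0 _ _ _ _ _ _ _ _ j) => //.
  by rewrite ffunE hj0 (hcomp_of_homog _ (gm_homog0 H 0)) if_same.
pose e : {ffun 'I_N.+1 -> hsupp h} :=
  [ffun j => [` mem_hsupp (h_d j) (h_n0 j)]%fset].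
rewrite (bigD1 e) //= [X in _ + X]big1 ?addr0 => [|d' d'_ne].
  congr (diamond_homog _ _ _ _ _ _); apply/ffunP=> j; rewrite !ffunE //=.
  by rewrite (hcomp_of_homog _ (h_d j)) eqxx.
(* Any other family of degrees differs from [d] at some [j], where the corresponding component of
   [h j] is zero. *)
have [j d'j_ne] : exists j, val (d' j) != d j.
  apply/existsP; apply: contraNT d'_ne => /existsPn d'E.
  apply/eqP/ffunP=> j; apply: val_inj; rewrite ffunE /=.
  by have /negPn/eqP := d'E j.
apply: (@diamond_homog_arg0 _ _ _ _ _ _ _ _ j) => //.
by rewrite ffunE (hcomp_of_homog _ (h_d j)) (negbTE d'j_ne).
Qed.

Definition self_diamond (N : nat) (m : int) (rho : cochain H)
    (h : {ffun 'I_N.+1 -> H}) : pseries H N :=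
  fun g => \sum_(k < N.+1) \sum_(l < N.+1 | (k + l == N)%N)
    diamond m (rho k) (rho l) h g.

Lemma bracket_self_odd (rho : Ccs H (-1)) (N : nat) (h : {ffun 'I_N.+1 -> H})
    (g : 'X_{1..N}) :
  bracket rho rho h g = 2%:R *: self_diamond (-1) rho h g.
Proof.
rewrite /bracket /self_diamond mulrNN mulr1 expr1z.
under eq_bigr => k _ do under eq_bigr => l _ do rewrite scaleN1r opprK.
under eq_bigr => k _ do rewrite big_split.
rewrite big_split /= scaler_nat mulr2n; congr (_ + _).
rewrite (exchange_big_dep predT) //=; apply: eq_bigr => l _.
by apply: eq_bigl => k; rewrite addnC.
Qed.

Lemma exprN1_oppz (n : int) : (-1 : C) ^ (- n) = (-1) ^ n.
Proof. by rewrite -exprz_inv invrN1. Qed.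

Lemma diamond_homog_odd (k l N : nat) (phi : multimap H k)
    (psi : multimap H l) d (h : {ffun 'I_N.+1 -> H}) g :
  diamond_homog (-1) phi psi d h g =
  \sum_(i < k.+1) \sum_(s : 'S_(i + l) | is_shuffle s)
    (koszul C s d * (-1) ^ (\sum_(j < i) d (inord (perm_nat s j))))
      *: insertion s phi psi h g.
Proof.
by apply: eq_bigr => i _; apply: eq_bigr => s _; rewrite mulN1r exprN1_oppz.
Qed.

Lemma leib_infty1_identityP (rho : cochain H) :
  (forall k, multilinear (rho k)) ->
  leib_infty1_identity rho <->
  forall N (h : {ffun 'I_N.+1 -> H}) g, self_diamond (-1) rho h g = 0.
Proof.
move=> rho_lin; split=> [rho_leib N h g | rho0 N d h h_d g].
  (* The range of the degree families depends on [h] but not on [k] and [l], so their sum can be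
     moved outermost; each family then gives one instance of the identity on homogeneous
     components. *)
  rewrite /self_diamond /diamond.
  under eq_bigr => k _ do rewrite exchange_big.
  rewrite exchange_big big1 // => d _.
  rewrite -[RHS](rho_leib N [ffun j => val (d j)]
    [ffun j => hcomp (h j) (val (d j))] _ g) => [|j]; last first.
    by rewrite !ffunE; apply: hcomp_homog.
  by apply: eq_bigr => k _; apply: eq_bigr => l _; rewrite diamond_homog_odd.
rewrite -[RHS](rho0 N h g); apply: eq_bigr => k _; apply: eq_bigr => l /eqP Nkl.
by rewrite (diamond_of_homog _ _ _ _ _ h_d) // diamond_homog_odd.
Qed.

Lemma maurer_cartanP (rho : Ccs H (-1)) :
  2%:R != 0 :> C -> maurer_cartan rho <-> leib_infty1_identity rho.
Proof.
move=> two_n0; rewrite leib_infty1_identityP; last first.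
  by move=> k; case: (ccs_sesquilinear rho k).
split=> [rho_mc N h g | rho0].
  apply/eqP; have /eqP := bracket_self_odd rho h g.
  by rewrite rho_mc eq_sym scaler_eq0 (negbTE two_n0).
apply: functional_extensionality_dep => N; apply/funext => h; apply/funext => g.
by rewrite bracket_self_odd rho0 scaler0.
Qed.

End LeibMaurerCartan.

Unset Implicit Arguments.

Theorem theorem3p8 (R : realType) (H : gradedModule R[i])
    (rho : forall k : nat, multimap H k)
    (rho_sesquilinear : forall k, conformal_sesquilinear (rho k))
    (rho_degree : forall k, has_degree (-1) (rho k)) :
  leib_infty1_conformal rho <->
  maurer_cartan (CcsElement rho_sesquilinear rho_degree).
Proof.
(* The field [R[i]] has characteristic zero, so the factor 2 can be cancelled. *)
rewrite maurer_cartanP ?pnatr_eq0 //.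
by split=> [[]|].
Qed.
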